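(* Let $Q:U\to H$ and $Q_n:U\to H$, $n\in\mathbb{N}$, be weakly sequentially closed, Fréchet differentiable operators with $$\|Q(u)-Q_n(u)\|_H\le\epsilon_n\quad\text{for all }u\in\mathcal{C}_{ad},\qquad \epsilon_n\downarrow0.$$ For each $n$ let $u_n$ be a minimizer of $\tfrac12\|Q_n(u)-g\|_H^2+\tfrac\alpha2\|u\|_U^2$ over $\mathcal{C}_{ad}$, and let $\bar u$ be the minimizer of $\tfrac12\|Q(u)-g\|_H^2+\tfrac\alpha2\|u\|_U^2$ over $\mathcal{C}_{ad}$. Assume that there are constants $L_0,L_1>0$ and numbers $\eta_n\in(0,1)$ with $\eta_n\downarrow0$ such that (i) $\|Q'(u)\|_{\mathcal{L}(U,H)}\le L_0$ for all $u\in\mathcal{C}_{ad}$; (ii) $\|Q'(u_a)-Q'(u_b)\|_{\mathcal{L}(U,H)}\le L_1\|u_a-u_b\|_U$ for all $u_a,u_b\in\mathcal{C}_{ad}$; (iii) $\|Q'(u)-Q_n'(u)\|_{\mathcal{L}(U,H)}\le\eta_n$ for all $u\in\mathcal{C}_{ad}$ and all $n\in\mathbb{N}$; (iv) $L_0(L_0+1)+L_1\|Q(\bar u)-g\|_H<\alpha$. Then $$\|u_n-\bar u\|_U\le\frac{1}{\alpha-L_0(L_0+\eta_n)-L_1\|Q(\bar u)-g\|_H}\Big(L_0\epsilon_n+\epsilon_n\eta_n+\|Q(\bar u)-g\|_H\,\eta_n\Big).$$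
   Context: $U$ and $H$ are Hilbert spaces, $g\in H$, $\alpha>0$, and $\mathcal{C}_{ad}\subset U$ is a nonempty, closed and convex set. An operator $Q:U\to H$ is weakly sequentially closed if $u_n\rightharpoonup u$ weakly in $U$ and $Q(u_n)\rightharpoonup\bar g$ weakly in $H$ imply $\bar g=Q(u)$. $Q'(u)\in\mathcal{L}(U,H)$ denotes the Fréchet derivative, and $\mathcal{L}(U,H)$ the bounded linear operators from $U$ to $H$ with the operator norm. *)

(* Defs.v *)
From HB Require Import structures.
From mathcomp Require Import all_boot all_order all_algebra.
From mathcomp Require Import all_classical all_reals all_analysis.

Set Implicit Arguments.
Unset Strict Implicit.
Unset Printing Implicit Defensive.

Import Order.TTheory GRing.Theory Num.Theory.
Import numFieldNormedType.Exports.

Local Open Scope classical_set_scope.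
Local Open Scope ring_scope.

(* Real Hilbert spaces: Banach spaces whose norm is induced by an inner
   product. *)
HB.mixin Record hasInner (R : realType) (U : Type)
    & CompleteNormedModule R U := {
  inner : {dot U for (@idfun R)} ;
  innerE : forall u : U, inner u u = `|u| ^+ 2
}.

#[short(type="hilbertType")]
HB.structure Definition Hilbert (R : realType) :=
  {U of CompleteNormedModule R U & hasInner R U}.

Section definitions.
Context {R : realType}.

Definition decreases_to0 (e : R^nat) : Prop :=
  nonincreasing_seq e /\ e @ \oo --> 0.

Definition weakly_cvg (U : hilbertType R) (u : U^nat) (l : U) : Prop :=
  forall f : {linear U -> R^o}, continuous f -> f \o u @ \oo --> f l.

Definition weakly_seq_closed (U H : hilbertType R) (Q : U -> H) : Prop :=
  forall (u_ : U^nat) (u : U) (h : H),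
    weakly_cvg u_ u -> weakly_cvg (Q \o u_) h -> h = Q u.

(* sup is 0 on unbounded sets, so this is the operator norm only for
   continuous f. *)
Definition opnorm (U H : hilbertType R) (f : {linear U -> H}) : R :=
  sup [set `|f v| | v in [set v : U | `|v| <= 1]].

Definition tikhonov (U H : hilbertType R) (Q : U -> H) (g : H) (alpha : R)
    (u : U) : R :=
  2^-1 * `|Q u - g| ^+ 2 + alpha / 2 * `|u| ^+ 2.

Definition minimizer (T : Type) (J : T -> R) (C : set T) (u : T) : Prop :=
  C u /\ forall v, C v -> J u <= J v.

End definitions.

(* Main.v *)
Require Import Defs.
From HB Require Import structures.
From mathcomp Require Import all_boot all_order all_algebra.
From mathcomp Require Import ring lra.
From mathcomp Require Import all_classical all_reals all_analysis.

Set Implicit Arguments.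
Unset Strict Implicit.
Unset Printing Implicit Defensive.

Import Order.TTheory GRing.Theory Num.Theory.
Import numFieldNormedType.Exports.

Local Open Scope classical_set_scope.
Local Open Scope ring_scope.

(** The estimate comes from comparing two first-order optimality conditions.
A minimizer [u] of a Tikhonov functional over a convex set satisfies the
variational inequality
  [0 <= <Q u - g, Q'(u) (v - u)> + alpha <u, v - u>]
for all admissible [v] ([first_order_condition]).  Taking it at [ubar] with
[v = un] and at [un], for the operator [Qn], with [v = ubar], and adding, one
gets for [d = un - ubar]
  [alpha |d|^2 <= <Q ubar - g, Q'(ubar) d - Qn'(un) d>
                  + <Q ubar - Qn un, Qn'(un) d>].

The three increments on the right are controlled by inserting [Q'(un) d] or
[Q un] between the two ends:
- [|Q'(ubar) d - Qn'(un) d| <= (L1 |d| + eta) |d|], by the Lipschitz bound on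
  [Q'] and the closeness of [Q'] and [Qn'];
- [|Qn'(un) d| <= (L0 + eta) |d|];
- [|Q ubar - Qn un| <= L0 |d| + eps], by the mean value inequality
  ([mean_value_bound]) on the segment from [ubar] to [un], which stays in the
  admissible set.
Cauchy-Schwarz then bounds [alpha |d|^2] by a quadratic polynomial in [|d|]
without constant term.  Its quadratic coefficient
[L0 (L0 + eta) + L1 |Q ubar - g|] is smaller than [alpha] because [eta < 1],
so dividing by [|d|] and solving for it gives the claim. *)

Section inner_product.
Context {R : realType} {U : hilbertType R}.
Implicit Types u v w : U.

Lemma inner_sym u v : inner u v = inner v u.
Proof. by rewrite hermC/= expr0 mul1r. Qed.

Lemma innerDr w u v : inner w (u + v) = inner w u + inner w v.
Proof. exact: linearDr. Qed.

Lemma innerDl w u v : inner (u + v) w = inner u w + inner v w.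
Proof. exact: linearDl. Qed.

Lemma innerBr w u v : inner w (u - v) = inner w u - inner w v.
Proof. exact: linearBr. Qed.

Lemma innerBl w u v : inner (u - v) w = inner u w - inner v w.
Proof. exact: linearBl. Qed.

Lemma innerNr u v : inner u (- v) = - inner u v.
Proof. exact: linearNr. Qed.

Lemma innerZr (a : R) u v : inner u (a *: v) = a * inner u v.
Proof. exact: linearZr_LR. Qed.

Lemma sqr_normD u v : `|u + v| ^+ 2 = `|u| ^+ 2 + 2 * inner u v + `|v| ^+ 2.
Proof.
rewrite -!innerE innerDr !innerDl (inner_sym v u); ring.
Qed.

(** Cauchy-Schwarz: expand the nonnegative square of [|v| u - |u| v]. *)
Lemma inner_le_norm u v : inner u v <= `|u| * `|v|.
Proof.
have := sqr_ge0 `| `|v| *: u - `|u| *: v|.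
have [->|u0] := eqVneq u 0; first by rewrite linear0l normr0 mul0r.
have [->|v0] := eqVneq v 0; first by rewrite linear0r normr0 mulr0.
rewrite sqr_normD normrN !normrZ !normr_id.
rewrite innerNr innerZr inner_sym innerZr inner_sym.
have : 0 < `|u| * `|v| by rewrite mulr_gt0 ?normr_gt0.
nra.
Qed.

Lemma norm_inner_le u v : `|inner u v| <= `|u| * `|v|.
Proof.
by rewrite ler_norml inner_le_norm andbT lerNl -innerNr -(normrN v)
  inner_le_norm.
Qed.

Lemma inner_continuous u : continuous (inner u : U -> R).
Proof.
move=> v; apply/(@cvgrPdist_le _ R^o) => e e0.
near=> w; rewrite -innerBr (le_trans (norm_inner_le _ _))//.
(* [|u| + 1] instead of [|u|], which may vanish and cannot be divided by. *)
have u1 : 0 < `|u| + 1 by rewrite ltr_wpDl.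
rewrite (@le_trans _ _ ((`|u| + 1) * `|v - w|))//.
  by rewrite ler_wpM2r// lerDl.
rewrite -ler_pdivlMl//; near: w.
by apply: cvgr_dist_le; [exact: cvg_id|rewrite mulr_gt0// invr_gt0].
Unshelve. all: by end_near. Qed.

End inner_product.

Section derivatives.
Context {R : realType} {U H : hilbertType R}.

(** Continuity is what makes [opnorm f] a supremum over a bounded set, hence a
bound for [f] on the unit ball. *)
Lemma opnorm_bound (f : {linear U -> H}) (K : R) (v : U) :
  continuous f -> opnorm f <= K -> `|f v| <= K * `|v|.
Proof.
move=> cf fK; have [->|v0] := eqVneq v 0; first by rewrite linear0 !normr0 mulr0.
have nv : 0 < `|v| by rewrite normr_gt0.
rewrite -ler_pdivrMr// (le_trans _ fK)//.
have [k k0 fk] := linear_lipschitz cf.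
apply: ub_le_sup.
  exists k => _ [w /= w1 <-].
  by rewrite (le_trans (fk w))// ger_pMr.
exists (`|v|^-1 *: v) => /=.
  by rewrite normrZ normfV normr_id mulVf ?gt_eqF.
by rewrite linearZ/= normrZ normfV normr_id mulrC.
Qed.

Lemma opnorm_diffB_bound (P Q : U -> H) (x y : U) (K : R) (v : U) :
  differentiable P x -> differentiable Q y ->
  opnorm ('d P x \- 'd Q y) <= K -> `|'d P x v - 'd Q y v| <= K * `|v|.
Proof.
move=> dP dQ /opnorm_bound; apply => w.
by apply: cvgB; apply: diff_continuous.
Qed.

Lemma diff_quotient_cvg (Q : U -> H) (x v : U) : differentiable Q x ->
  h^-1 *: (Q (x + h *: v) - Q x) @[h --> 0^'] --> 'd Q x v.
Proof.
move=> dQ; rewrite -deriveE//.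
have := @diff_derivable _ _ _ Q x v dQ.
rewrite /derivable /derive /=.
have -> : (fun h : R => h^-1 *: (Q (h *: v + x) - Q x)) =
    (fun h : R => h^-1 *: (Q (x + h *: v) - Q x)).
  by apply/funext => h; rewrite (addrC x).
exact.
Qed.

Lemma is_derive_inner_line (Q : U -> H) (x v : U) (h : H) (s : R) :
  differentiable Q (x + s *: v) ->
  is_derive s 1 (fun t : R => inner h (Q (x + t *: v)) : R)
    (inner h ('d Q (x + s *: v) v)).
Proof.
move=> dQ.
suff cv : (fun t : R => t^-1 *: ((inner h (Q (x + (t *: 1 + s) *: v)) : R)
    - inner h (Q (x + s *: v)))) @ 0^' --> (inner h ('d Q (x + s *: v) v) : R).
  by split; [apply/cvg_ex; eexists; exact: cv|exact: cvg_lim cv].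
have := cvg_comp _ _ (@diff_quotient_cvg Q _ v dQ) (@inner_continuous _ _ h _).
apply: cvg_trans; apply: near_eq_cvg; apply: nearW => t /=.
rewrite -innerBr innerZr; congr (_ * inner h (Q _ - _)).
by rewrite [t *: 1]mulr1 scalerDl -addrA [t *: v + _]addrC.
Qed.

(** The mean value theorem has no equality form for vector-valued maps, so it is applied to
the scalar function [t |-> <h, Q (x + t v)>] where [h] is the increment
[Q (x + v) - Q x] itself.  This bounds [|h|^2] by [|h| (K |v|)]. *)
Lemma mean_value_bound (Q : U -> H) (x v : U) (K : R) :
  (forall u, differentiable Q u) ->
  (forall t : R, 0 < t < 1 -> `|'d Q (x + t *: v) v| <= K * `|v|) ->
  `|Q (x + v) - Q x| <= K * `|v|.
Proof.
move=> dQ QK; set h := Q (x + v) - Q x.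
(* [K |v|] is nonnegative, as seen at an arbitrary interior [t]. *)
have [h0|h0] := eqVneq h 0.
  rewrite h0 normr0.
  by apply: le_trans (QK (1 / 2) _) => //; lra.
have dphi (s : R) : is_derive s 1 (fun t : R => inner h (Q (x + t *: v)) : R)
   (inner h ('d Q (x + s *: v) v)) by exact: is_derive_inner_line.
have [|c] := @MVT R (fun t : R => inner h (Q (x + t *: v)))
   (fun s : R => inner h ('d Q (x + s *: v) v)) 0 1 ltr01.
  apply: continuous_subspaceT => s; apply: differentiable_continuous.
  by apply/derivable1_diffP; case: (dphi s).
rewrite in_itv/= => c01; rewrite scale1r scale0r addr0 subr0 mulr1 -innerBr.
rewrite -/h innerE => hE.
have : `|h| ^+ 2 <= `|h| * (K * `|v|).
  by rewrite hE (le_trans (inner_le_norm _ _))// ler_wpM2l// QK.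
by rewrite expr2 ler_pM2l// normr_gt0.
Qed.

End derivatives.

Lemma segment_in_convex (R : realType) (U : hilbertType R) (C : set U)
    (u v : U) (t : R) :
  convex_set (C : set (convex_lmodType U)) -> C u -> C v -> 0 <= t <= 1 ->
  C (u + t *: (v - u)).
Proof.
move=> cC Cu Cv /andP[t0 t1].
have := cC v u (Itv01 t0 t1) (mem_set Cv) (mem_set Cu).
rewrite inE; congr (C _).
rewrite -[LHS]/(t *: v + (1 - t) *: u) scalerBl scale1r scalerBr addrC -addrA.
by congr (_ + _); rewrite addrC.
Qed.

(** The point [u + t (v - u)] is admissible for [0 <= t <= 1].  With [w t] the
difference quotient of [Q] towards [v], the increment of the functional there
is [t * b t], where [b] is explicit because the functional is quadratic in
[Q u - g] and [u].  Hence [b t >= 0] for small [t > 0], and [b] tends to the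
right-hand side as [t] decreases to [0]. *)
Lemma first_order_condition (R : realType) (U H : hilbertType R) (Q : U -> H)
    (g : H) (alpha : R) (C : set U) (u v : U) :
  convex_set (C : set (convex_lmodType U)) -> differentiable Q u ->
  minimizer (tikhonov Q g alpha) C u -> C v ->
  0 <= inner (Q u - g) ('d Q u (v - u)) + alpha * inner u (v - u).
Proof.
move=> cC dQ [Cu umin] Cv; set d := v - u.
pose w t := t^-1 *: (Q (u + t *: d) - Q u).
pose b t : R := inner (Q u - g) (w t) + t / 2 * `|w t| ^+ 2 +
   alpha * (inner u d + t / 2 * `|d| ^+ 2).
have wd : w t @[t --> 0^'+] --> 'd Q u d.
  by apply: cvg_dnbhs_at_right; exact: (@diff_quotient_cvg _ _ _ Q _ d dQ).
have half0 : (t / 2 : R) @[t --> 0^'+] --> (0 : R).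
  rewrite -[X in _ --> X](mul0r (2^-1 : R)).
  by apply: cvgM; [apply: cvg_at_right_filter; exact: cvg_id|exact: cvg_cst].
have bcvg : b t @[t --> 0^'+] -->
    (inner (Q u - g) ('d Q u d) + alpha * inner u d : R).
  rewrite -[X in _ --> X + _]addr0 -[X in _ --> _ + alpha * X]addr0.
  rewrite -[X in _ --> _ + X + _](mul0r (`|'d Q u d| ^+ 2)).
  rewrite -[X in _ --> _ + alpha * (_ + X)](mul0r (`|d| ^+ 2)).
  apply: cvgD; last first.
    apply: cvgM; first exact: cvg_cst.
    by apply: cvgD; [exact: cvg_cst|apply: cvgM => //; exact: cvg_cst].
  apply: cvgD; first exact: (cvg_comp _ _ wd (@inner_continuous _ _ _ _)).
  by apply: cvgM => //; rewrite !expr2; apply: cvgM; exact: cvg_norm.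
apply: (cvgr_to_ge bcvg).
near=> t.
have t0 : 0 < t by [].
have t01 : 0 <= t <= 1 by rewrite ltW//=; near: t; exact: nbhs_right_le.
rewrite -(pmulr_rge0 _ t0).
have := umin _ (segment_in_convex cC Cu Cv t01).
rewrite /tikhonov; have -> : Q (u + t *: (v - u)) - g = (Q u - g) + t *: w t.
  by rewrite /w scalerA mulfV ?gt_eqF// scale1r [RHS]addrC addrA subrK.
(* [d] and the residual are made opaque so that [sqr_normD] expands only the
   two sums that depend on [t]. *)
rewrite /b -/d; move: (Q u - g) (w t) => q z; clearbody d.
rewrite !sqr_normD !normrZ !innerZr gtr0_norm//.
lra.
Unshelve. all: by end_near. Qed.

Theorem theorem2p5 (R : realType) (U H : hilbertType R) (g : H) (alpha : R)
    (Cad : set U) (Q : U -> H) (Qn : nat -> U -> H) (eps eta : R^nat)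
    (un : U^nat) (ubar : U) (L0 L1 : R) :
  0 < alpha ->
  Cad !=set0 -> closed Cad -> convex_set (Cad : set (convex_lmodType U)) ->
  weakly_seq_closed Q -> (forall u, differentiable Q u) ->
  (forall n, weakly_seq_closed (Qn n)) ->
  (forall n u, differentiable (Qn n) u) ->
  (forall n u, Cad u -> `|Q u - Qn n u| <= eps n) ->
  decreases_to0 eps ->
  (forall n, minimizer (tikhonov (Qn n) g alpha) Cad (un n)) ->
  minimizer (tikhonov Q g alpha) Cad ubar ->
  0 < L0 -> 0 < L1 ->
  (forall n, 0 < eta n < 1) -> decreases_to0 eta ->
  (forall u, Cad u -> opnorm ('d Q u) <= L0) ->
  (forall ua ub, Cad ua -> Cad ub ->
    opnorm ('d Q ua \- 'd Q ub) <= L1 * `|ua - ub|) ->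
  (forall u n, Cad u -> opnorm ('d Q u \- 'd (Qn n) u) <= eta n) ->
  L0 * (L0 + 1) + L1 * `|Q ubar - g| < alpha ->
  forall n,
    `|un n - ubar| <=
      1 / (alpha - L0 * (L0 + eta n) - L1 * `|Q ubar - g|) *
      (L0 * eps n + eps n * eta n + `|Q ubar - g| * eta n).
Proof.
move=> alpha0 _ _ cC _ dQ _ dQn QQn _ unmin ubmin L00 L10 eta01 _ dQL0 dQL1
  dQeta smallness n.
have [Cun _] := unmin n; have [Cub _] := ubmin.
have /andP[eta0 eta1] := eta01 n.
have eps0 : 0 <= eps n by exact: le_trans (normr_ge0 _) (QQn n _ Cub).
set d := un n - ubar; set r := `|Q ubar - g|.
have r0 : 0 <= r by exact: normr_ge0.
have d0 : 0 <= `|d| by exact: normr_ge0.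
have opt_ubar := first_order_condition cC (dQ ubar) ubmin Cun.
have opt_un := first_order_condition cC (dQn n (un n)) (unmin n) Cub.
have dE : ubar - un n = - d by rewrite opprB.
rewrite -/d in opt_ubar; rewrite dE linearN !innerNr in opt_un.
have variational_gap : alpha * `|d| ^+ 2 <=
    inner (Q ubar - g) ('d Q ubar d - 'd (Qn n) (un n) d) +
    inner (Q ubar - Qn n (un n)) ('d (Qn n) (un n) d).
  have -> : Q ubar - Qn n (un n) = (Q ubar - g) - (Qn n (un n) - g).
    by rewrite opprB addrA subrK.
  (* the sum of [opt_ubar] and [opt_un] *)
  rewrite -innerE innerBr !(inner_sym d) (innerBl _ (Q ubar - g)).
  lra.
have dQn_dQ : `|'d Q (un n) d - 'd (Qn n) (un n) d| <= eta n * `|d|.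
  exact: opnorm_diffB_bound (dQeta _ _ Cun).
have derivative_gap :
    `|'d Q ubar d - 'd (Qn n) (un n) d| <= (L1 * `|d| + eta n) * `|d|.
  rewrite -(subrK ('d Q (un n) d) ('d Q ubar d)) -addrA.
  rewrite (le_trans (ler_normD _ _))// mulrDl lerD//.
  by apply: opnorm_diffB_bound => //; rewrite /d distrC; exact: dQL1.
have dQn_bound : `|'d (Qn n) (un n) d| <= (L0 + eta n) * `|d|.
  rewrite -(subrK ('d Q (un n) d) ('d (Qn n) (un n) d)).
  rewrite (le_trans (ler_normD _ _))// mulrDl addrC lerD//; last by rewrite distrC.
  by apply: opnorm_bound (dQL0 _ Cun); exact: diff_continuous.
have value_gap : `|Q ubar - Qn n (un n)| <= L0 * `|d| + eps n.
  rewrite -(subrK (Q (un n)) (Q ubar)) -addrA.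
  rewrite (le_trans (ler_normD _ _))// lerD ?QQn//.
  have -> : un n = ubar + d by rewrite /d addrC subrK.
  rewrite distrC.
  apply: mean_value_bound => // t /andP[t0 t1].
  apply: opnorm_bound; first exact: diff_continuous.
  by apply: dQL0; apply: segment_in_convex => //; rewrite !ltW.
have D0 : 0 < alpha - L0 * (L0 + eta n) - L1 * r.
  have : L0 * (L0 + eta n) <= L0 * (L0 + 1) by rewrite ler_pM2l// lerD2l ltW.
  by move: smallness; rewrite -/r; lra.
rewrite mul1r mulrC ler_pdivlMr//.
have [->|dn0] := eqVneq `|d| 0.
  by rewrite mul0r !addr_ge0// mulr_ge0// ltW.
have dgt0 : 0 < `|d| by rewrite lt_def dn0.
rewrite -(ler_pM2l dgt0).
have first_term := le_trans (inner_le_norm (Q ubar - g) _)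
  (ler_wpM2l r0 derivative_gap).
have second_term := le_trans (inner_le_norm (Q ubar - Qn n (un n)) _)
  (ler_pM (normr_ge0 _) (normr_ge0 _) value_gap dQn_bound).
have := le_trans variational_gap (lerD first_term second_term).
by rewrite -/r; lra.
Qed.
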